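(* Let $\omega=\mu+g(0)$ and let $\rho_0\in C^1(\mathbb{R})\cap W^{1,\infty}(\mathbb{R})$, $v_0\in C^2(\mathbb{R})\cap W^{2,\infty}(\mathbb{R})$ with $\rho_0(x)>0$ for all $x\in\mathbb{R}$ satisfy $$\inf_{x\in\mathbb{R}}v_0'(x)>-\omega,$$ $$\sup_{x\in\mathbb{R}}\rho_0(x)\le\bar\rho\Big(1+\omega^{-1}\min\Big(0,\inf_{x\in\mathbb{R}}v_0'(x)\Big)\Big).$$ Then the macroscopic model $$\rho_t+v\rho_x+\rho v_x=0,$$ $$v_t+vv_x-\Xi=-\big(\mu+g(\Xi)\big)(v-v^* ),\qquad \Xi:=-\rho_x\big(2\Phi'(\rho)+\rho\,\Phi''(\rho)\big),$$ with initial conditions $\rho(0,x)=\rho_0(x)$, $v(0,x)=v_0(x)$ for $x\in\mathbb{R}$, has a solution $(\rho(t,x),v(t,x))$ that satisfies $$\sup_{x\in\mathbb{R}}\rho(t,x)\le\bar\rho\quad\text{for all } t\ge0,$$ $$\sup_{x\in\mathbb{R}}|v(t,x)-v^*|\le\exp(-\omega t)\sup_{x\in\mathbb{R}}|v_0(x)-v^*|\quad\text{for all } t\ge0,$$ $$\rho(t,x)>0\quad\text{for all } t\ge0,\ x\in\mathbb{R},$$ and there exists a function $h:\mathbb{R}\to(0,\bar\rho]$ of class $C^1(\mathbb{R})\cap L^\infty(\mathbb{R})$ for which $$\sup_{x\in\mathbb{R},\,t\ge0}\Big(|\rho(t,x)-h(x-v^*t)|\exp(\omega t)\Big)<+\i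nfty.$$
   Context: $\mu>0$, $v_{\max}>v^*>0$, $\rho_{\max}>0$ and $\bar\rho\in(0,\rho_{\max})$ are constants. $f\in C^1(\mathbb{R})$ is a non-decreasing function with $\max(x,0)\le f(x)$ for all $x\in\mathbb{R}$, and $$g(x)=\frac{v_{\max}f(x)}{v^*(v_{\max}-v^* )}-\frac{x}{v^*},\quad x\in\mathbb{R}.$$ $\Phi:(0,\rho_{\max})\to[0,+\infty)$ is a $C^3$ function satisfying: $\lim_{\rho\to\rho_{\max}^-}\Phi(\rho)=+\infty$; $\Phi(\rho)=0$ for all $\rho\in(0,\bar\rho]$; $\Phi'(\rho)>0$ for all $\rho\in(\bar\rho,\rho_{\max})$; $\Phi''(\rho)\ge0$ for all $\rho\in(0,\rho_{\max})$. Here $\rho(t,x)$ is traffic density and $v(t,x)$ is mean speed. $W^{k,\infty}(\mathbb{R})$ denotes the Sobolev space of $L^\infty(\mathbb{R})$ functions with weak derivatives of order $\le k$ all in $L^\infty(\mathbb{R})$. Solutions are classical: $C^1$ functions on $[0,+\infty)\times\mathbb{R}$ satisfying the equations pointwise. *)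

(* Defs.v *)
From mathcomp Require Import all_boot all_order all_algebra.
From mathcomp Require Import all_classical all_reals all_analysis.

Set Implicit Arguments.
Unset Strict Implicit.
Unset Printing Implicit Defensive.
Import Order.TTheory GRing.Theory Num.Theory.
Import numFieldNormedType.Exports.

Local Open Scope classical_set_scope.
Local Open Scope ring_scope.

(* Suprema and infima over the real line are taken in the extended reals, so
   that unbounded functions get +oo/-oo and not the default value of the real
   [sup] and [inf]. *)
Definition supR (R : realType) (f : R -> R) : \bar R :=
  ereal_sup [set (f x)%:E | x in [set: R]].

Definition infR (R : realType) (f : R -> R) : \bar R :=
  ereal_inf [set (f x)%:E | x in [set: R]].

(* Functions of class C^k on an open set A. *)
Definition classC (R : realType) (k : nat) (A : set R) (f : R -> R) : Prop :=
  (forall j, (j < k)%N -> forall x : R, A x -> derivable (derive1n j f) x 1) /\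
  (forall x : R, A x -> {for x, continuous (derive1n k f)}).

Definition test_function (R : realType) (phi : R -> R) : Prop :=
  (forall k, classC k setT phi) /\ compact (closure [set x | phi x != 0]).

Definition Linfty (R : realType) (f : R -> R) : Prop :=
  f \in Lfun (@lebesgue_measure R) +oo%E.

(* g is a weak derivative of order j of f; the integrals are finite as soon as
   f and g are in L^oo. *)
Definition weak_derivative (R : realType) (j : nat) (f g : R -> R) : Prop :=
  forall phi : R -> R, test_function phi ->
    \int[@lebesgue_measure R]_x (f x * derive1n j phi x) =
    (-1) ^+ j * \int[@lebesgue_measure R]_x (g x * phi x).

Definition Wkinfty (R : realType) (k : nat) (f : R -> R) : Prop :=
  Linfty f /\
  forall j, (j <= k)%N -> exists2 g, Linfty g & weak_derivative j f g.

(* Functions of (t, x) are only relevant on t >= 0: the difference quotients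
   in time use times s >= 0 only, so the time derivative is one-sided at
   t = 0 and the usual one at t > 0. *)
Definition half_plane (R : realType) : set (R * R) := [set p | 0 <= p.1].

Definition time_quotient (R : realType) (u : R -> R -> R) (t x : R) : set_system R :=
  (u s x - u t x) / (s - t) @[s --> within [set s | 0 <= s] t^'].

Definition d_t (R : realType) (u : R -> R -> R) (t x : R) : R :=
  lim (time_quotient u t x).

Definition d_x (R : realType) (u : R -> R -> R) (t x : R) : R := derive1 (u t) x.

Definition C1_half_plane (R : realType) (u : R -> R -> R) : Prop :=
  [/\ forall t x : R, 0 <= t -> cvg (time_quotient u t x),
      forall t x : R, 0 <= t -> derivable (u t) x 1,
      {within @half_plane R, continuous (fun p : R * R => u p.1 p.2)},
      {within @half_plane R, continuous (fun p : R * R => d_t u p.1 p.2)} &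
      {within @half_plane R, continuous (fun p : R * R => d_x u p.1 p.2)}].

Definition relaxation_g (R : realType) (vmax vstar : R) (f : R -> R) (x : R) : R :=
  vmax * f x / (vstar * (vmax - vstar)) - x / vstar.

Definition Xi (R : realType) (Phi : R -> R) (rho : R -> R -> R) (t x : R) : R :=
  - d_x rho t x * (2 * derive1 Phi (rho t x) + rho t x * derive1n 2 Phi (rho t x)).

(* Phi is a total function here, but only meaningful on ]0, rhomax[; hence the
   requirement that the density takes its values in this interval. *)
Record classical_solution (R : realType) (mu vstar rhomax : R) (g Phi : R -> R)
    (rho0 v0 : R -> R) (rho v : R -> R -> R) : Prop := ClassicalSolution {
  solution_C1_density : C1_half_plane rho ;
  solution_C1_speed : C1_half_plane v ;
  solution_range : forall t x : R, 0 <= t -> 0 < rho t x < rhomax ;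
  solution_continuity_equation : forall t x : R, 0 <= t ->
    d_t rho t x + v t x * d_x rho t x + rho t x * d_x v t x = 0 ;
  solution_speed_equation : forall t x : R, 0 <= t ->
    d_t v t x + v t x * d_x v t x - Xi Phi rho t x =
    - (mu + g (Xi Phi rho t x)) * (v t x - vstar) ;
  solution_initial_density : forall x : R, rho 0 x = rho0 x ;
  solution_initial_speed : forall x : R, v 0 x = v0 x
}.

(* Main.v *)
(* While [rho <= rhobar] the pressure terms vanish, so Xi = 0 and the system is
   Burgers' equation with relaxation coupled to a transport equation.  Writing
   a(t) = (1 - exp (- omega t)) / omega and w = v0 - vstar, the characteristic
   issued from z is z + vstar t + a(t) w(z), along which v - vstar decays like
   exp (- omega t) and the density is rho0(z) / (1 + a(t) v0'(z)).  The bounds on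
   v0' and rho0 say exactly that this Jacobian stays bounded away from 0 and that
   the density stays below rhobar.  In the moving frame x - vstar t the density
   depends on t only through a(t), in a Lipschitz way; h is its value at
   a = 1 / omega, and 1 / omega - a(t) = exp (- omega t) / omega gives the rate.

   The Lipschitz constant needs pointwise bounds on the classical derivatives;
   these come from the weak ones by testing against smooth bumps. *)

Require Import Defs.
From mathcomp Require Import all_boot all_order all_algebra.
From mathcomp Require Import all_classical all_reals all_analysis.
From mathcomp Require Import measurable_realfun ess_sup_inf ring lra.

Set Implicit Arguments.
Unset Strict Implicit.
Unset Printing Implicit Defensive.
Import Order.TTheory GRing.Theory Num.Theory.
Import numFieldNormedType.Exports.

Local Open Scope classical_set_scope.
Local Open Scope ring_scope.

(** * Smooth bumps built from exp(-1/x) *)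

Lemma is_derive_continuous (R : realType) (f : R -> R) (x a : R) :
  is_derive x 1 f a -> {for x, continuous f}.
Proof. by case=> /derivable1_diffP/differentiable_continuous. Qed.

(** Induction on [p]: half of the exponential absorbs the tail by induction, the other half absorbs
    the extra factor [y], since [c / 2 * y <= expR (c / 2 * y)]. The rate [c] is arbitrary so that
    it can be halved. *)
Lemma horner_le_expR (R : realType) (p : {poly R}) (c : R) : 0 < c ->
  exists2 C, 0 <= C & forall y, 0 <= y -> `|p.[y]| <= C * expR (c * y).
Proof.
elim/poly_ind: p c => [|p k IH] c c0.
  by exists 0 => // y _; rewrite horner0 normr0 mul0r.
have c20 : 0 < c / 2 by rewrite divr_gt0.
have [C C0 HC] := IH _ c20.
exists (C * (c / 2)^-1 + `|k|).
  by rewrite addr_ge0// mulr_ge0// invr_ge0 ltW.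
move=> y y0; rewrite hornerMXaddC (le_trans (ler_normD _ _))// mulrDl lerD//.
  rewrite normrM (ger0_norm y0).
  have -> : expR (c * y) = expR (c / 2 * y) * expR (c / 2 * y).
    by rewrite -expRD; congr expR; field.
  have -> : C / (c / 2) * (expR (c / 2 * y) * expR (c / 2 * y)) =
            (C * expR (c / 2 * y)) * ((c / 2)^-1 * expR (c / 2 * y)) by ring.
  apply: ler_pM => //; first exact: HC.
  rewrite ler_pdivlMl// (le_trans _ (expR_ge1Dx _))// lerDr//.
rewrite ler_peMr// -expR0 ler_expR mulr_ge0// ltW//.
Qed.

(* The functions p(1/x) exp(-1/x) are closed under derivation, so smoothness of
   the family is a plain induction on the order. *)
Definition flat (R : realType) (p : {poly R}) (x : R) : R :=
  if 0 < x then p.[x^-1] * expR (- x^-1) else 0.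

Lemma flat0 (R : realType) (p : {poly R}) (x : R) : x <= 0 -> flat p x = 0.
Proof. by rewrite /flat leNgt; case: ltP. Qed.

Lemma flat1_gt0 (R : realType) (x : R) : 0 < x -> 0 < flat 1 x.
Proof. by move=> x0; rewrite /flat x0 hornerE mul1r expR_gt0. Qed.

(** The exponential bound, applied to [p * 'X] at [x^-1], leaves one spare factor [x]: [flat p x] is
    at most [C * x] in absolute value for [0 < x]. *)
Lemma continuous0_flat (R : realType) (p : {poly R}) : {for 0, continuous (flat p)}.
Proof.
have [C C0 HC] := horner_le_expR (p * 'X) (@ltr01 R).
suff H : flat p x @[x --> (0:R)] --> (0:R) by rewrite /prop_for /continuous_at flat0.
apply/cvgr0Pnorm_le => e e0.
have C10 : 0 < C + 1 by rewrite ltr_pwDr.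
have d0 : 0 < (C + 1)^-1 * e by rewrite mulr_gt0// invr_gt0.
apply: filterS (@nbhs0_lt _ R _ d0) => x xd.
have [x0|x0] := ltP 0 x; last by rewrite flat0// normr0 ltW.
rewrite /flat x0.
have xV0 : 0 < x^-1 by rewrite invr_gt0.
have := HC x^-1 (ltW xV0); rewrite hornerMX mul1r normrM (gtr0_norm xV0).
rewrite ler_pdivrMr// => H.
rewrite normrM (gtr0_norm (expR_gt0 _)) expRN ler_pdivrMr ?expR_gt0//.
apply: (le_trans H); rewrite mulrAC ler_wpM2r ?expR_ge0//.
apply: (@le_trans _ _ ((C + 1) * x)); first by rewrite ler_wpM2r ?(ltW x0)// lerDl.
by rewrite -ler_pdivlMl// (le_trans (ler_norm _))// ltW.
Qed.

(** For positive x the chain rule brings out the factor [x ^- 2], that is ['X^2] evaluated at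
    [x^-1]. At 0 the difference quotient of [flat p] is [flat ('X * p)], already known to be
    continuous there with value 0. *)
Lemma is_derive_flat (R : realType) (p : {poly R}) (x : R) :
  is_derive x 1 (flat p) (flat ('X^2 * (p - p^`())) x).
Proof.
have [x0|x0|->] := ltgtP x 0.
- rewrite (flat0 _ (ltW x0)).
  apply: (@near_eq_is_derive _ _ _ (cst 0)).
  by near=> z; rewrite flat0//= ltW//; near: z; exact: lt_nbhsl.
- rewrite /flat x0.
  apply: (@near_eq_is_derive _ R R (fun z : R => p.[z^-1] * expR (- z^-1))).
    by near=> z; rewrite ifT//; near: z; exact: lt_nbhsr.
  have xn0 : x != 0 by rewrite gt_eqF.
  have Hi : is_derive x 1 (@GRing.inv R) (- x ^- 2).
    have := @is_deriveV _ id x 1 1 xn0 (is_derive_id _ _).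
    by rewrite /GRing.scale/= mulr1.
  have Hp : is_derive x^-1 1 (horner p) (p^`().[x^-1]).
    by rewrite derivE derive1E; apply: derivableP; exact: derivable_horner.
  have H1 := @is_derive1_comp _ _ _ _ _ _ Hp Hi.
  have H2 := @is_derive1_comp _ expR (- (@GRing.inv R : R -> R)) _ _ _
    (is_derive_expR _) (is_deriveN Hi).
  have H3 := is_deriveM H1 H2.
  apply: (is_derive_eq H3).
  rewrite /GRing.scale/= hornerM hornerXn hornerD hornerN.
  by rewrite -[(- @GRing.inv R) x]/(- x^-1) exprVn; ring.
- rewrite [flat _ 0]flat0//.
  apply/is_derive1_caratheodory; exists (flat ('X * p)); split.
  + move=> z; rewrite subr0 [flat _ 0]flat0// subr0.
    have [z0|z0] := ltP 0 z; last by rewrite !flat0// mul0r.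
    by rewrite /flat z0 hornerM hornerX; field; rewrite gt_eqF.
  + exact: continuous0_flat.
  + by rewrite flat0.
Unshelve. all: by end_near. Qed.

(** Derivatives appear as witnesses and not through [derive1n], so that closure under sums, products
    and affine substitution is an induction on the order; the conversion to [classC] is done once at
    the end. *)
Fixpoint smooth_upto (R : realType) (n : nat) (f : R -> R) : Prop :=
  if n is m.+1 then
    exists2 f' : R -> R, forall x : R, is_derive x 1 f (f' x) & smooth_upto m f'
  else continuous f.

Lemma smooth_uptoW (R : realType) n (f : R -> R) :
  smooth_upto n.+1 f -> smooth_upto n f.
Proof.
elim: n f => [|n IH] f [f' ff' Hf'].
  by move=> x; apply: is_derive_continuous (ff' x).
by exists f' => //; exact: IH.
Qed.

Lemma smooth_uptoD (R : realType) n (f g : R -> R) :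
  smooth_upto n f -> smooth_upto n g -> smooth_upto n (f + g).
Proof.
elim: n f g => [|n IH] f g; first by move=> cf cg x; apply: continuousD; [exact: cf|exact: cg].
move=> [f' ff' Hf'] [g' gg' Hg']; exists (f' + g'); last exact: IH.
by move=> x; apply: is_deriveD.
Qed.

Lemma smooth_uptoM (R : realType) n (f g : R -> R) :
  smooth_upto n f -> smooth_upto n g -> smooth_upto n (f * g).
Proof.
elim: n f g => [|n IH] f g; first by move=> cf cg x; apply: continuousM; [exact: cf|exact: cg].
move=> Hf Hg; have [f' ff' Hf'] := Hf; have [g' gg' Hg'] := Hg.
exists (f * g' + g * f'); last first.
  by apply: smooth_uptoD; apply: IH => //; exact: smooth_uptoW.
by move=> x; apply: is_deriveM.
Qed.

Lemma smooth_upto_affine (R : realType) n (f : R -> R) (c d : R) :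
  smooth_upto n f -> smooth_upto n (fun x => f (c * x + d)).
Proof.
have aff (x : R) : is_derive x 1 (fun x : R => c * x + d) c.
  have := is_deriveD (is_deriveZ c (is_derive_id x 1)) (is_derive_cst d x 1).
  by rewrite addr0 /GRing.scale/= mulr1.
elim: n f => [|n IH] f.
  move=> cf x; apply: continuous_comp; last exact: cf.
  exact: is_derive_continuous (aff x).
move=> [f' ff' Hf']; exists ((fun x => f' (c * x + d)) * cst c).
  by move=> x; apply: (@is_derive1_comp _ f (fun x => c * x + d)) => //; exact: ff'.
apply: smooth_uptoM; first exact: IH.
elim: n {IH Hf'} c {aff} => [|n IHn] c; first by move=> x; exact: cst_continuous.
by exists (cst 0); [move=> x; exact: is_derive_cst|exact: IHn].
Qed.

Lemma smooth_upto_flat (R : realType) n (p : {poly R}) : smooth_upto n (flat p).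
Proof.
elim: n p => [|n IH] p; last first.
  by exists (flat ('X^2 * (p - p^`()))) => //; exact: is_derive_flat.
move=> x; exact: is_derive_continuous (is_derive_flat p x).
Qed.

Lemma smooth_upto_classC (R : realType) n (f : R -> R) :
  smooth_upto n f -> classC n setT f.
Proof.
elim: n f => [|n IH] f.
  by move=> cf; split=> // x _; exact: cf.
move=> [f' ff' /IH[df' cf']].
have f'E : derive1 f = f'.
  by apply/funext => x; rewrite derive1E; exact: derive_val.
split=> [[|j] jn x _|x _]; first by case: (ff' x).
  by rewrite derive1Sn f'E; apply: df'.
by rewrite derive1Sn f'E; exact: cf'.
Qed.

Definition bump (R : realType) (a b x : R) : R := flat 1 (x - a) * flat 1 (b - x).

Lemma bump_ge0 (R : realType) (a b x : R) : 0 <= bump a b x.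
Proof. by rewrite mulr_ge0// /flat; case: ifPn => //; rewrite hornerE mul1r expR_ge0. Qed.

Lemma bump_gt0 (R : realType) (a b x : R) : a < x < b -> 0 < bump a b x.
Proof. by move=> /andP[ax xb]; rewrite mulr_gt0// flat1_gt0// subr_gt0. Qed.

Lemma bump_out (R : realType) (a b x : R) : x \notin `[a, b] -> bump a b x = 0.
Proof.
rewrite in_itv/= negb_and -!ltNge => /orP[xa|bx]; rewrite /bump.
  by rewrite flat0 ?mul0r// subr_le0 ltW.
by rewrite [flat _ (b - x)]flat0 ?mulr0// subr_le0 ltW.
Qed.

Lemma test_function_bump (R : realType) (a b : R) : test_function (bump a b).
Proof.
split.
  move=> k; apply: smooth_upto_classC.
  rewrite (_ : bump a b = (fun x => flat 1 (1 * x + (- a))) * (fun x => flat 1 (-1 * x + b))).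
    by apply: smooth_uptoM; apply: smooth_upto_affine; exact: smooth_upto_flat.
  apply/funext => x; rewrite -[RHS]/(flat 1 (1 * x - a) * flat 1 (-1 * x + b)).
  by rewrite mul1r mulN1r [- x + b]addrC.
apply: (subclosed_compact (@closed_closure _ _) (@segment_compact _ a b)).
rewrite [X in _ `<=` X](closure_id _).1; last exact: interval_closed.
apply: closure_subset => x /= ; apply: contraNT => /bump_out ->//.
Qed.

(** * Integration by parts against functions vanishing outside an interval *)

Lemma classC_derive1 (R : realType) k (f : R -> R) :
  classC k.+1 setT f -> classC k setT (derive1 f).
Proof.
move=> [df cf]; split=> [j jk x _|x _].
  by rewrite -derive1Sn; apply: df.
by rewrite -derive1Sn; exact: cf.
Qed.

Lemma classC_is_derive (R : realType) k (f : R -> R) (x : R) :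
  classC k.+1 setT f -> is_derive x 1 f (derive1 f x).
Proof. by move=> [/(_ 0%N isT x I) df _]; rewrite derive1E; exact: derivableP. Qed.

Lemma classC_continuous (R : realType) k (f : R -> R) :
  classC k setT f -> continuous f.
Proof.
case: k => [[_ cf] x|k Cf x]; first exact: cf.
exact: is_derive_continuous (classC_is_derive x Cf).
Qed.

Lemma classC_derive1n (R : realType) k j (f : R -> R) :
  classC (j + k) setT f -> classC k setT (derive1n j f).
Proof.
elim: j f => [|j IH] f //; rewrite addSn => /classC_derive1 /IH.
by rewrite -derive1Sn.
Qed.

Lemma classCW (R : realType) k (f : R -> R) : classC k.+1 setT f -> classC k setT f.
Proof.
move=> [df cf]; split=> [j jk x _|x _]; first by apply: df => //; exact: ltnW.
have := df k (ltnSn k) x I.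
by move=> /derivable1_diffP/differentiable_continuous.
Qed.

Lemma derive1_vanish (R : realType) (f : R -> R) (a b : R) :
  (forall x, x \notin `[a, b] -> f x = 0) ->
  forall x, x \notin `[a, b] -> derive1 f x = 0.
Proof.
move=> f0 x xab; rewrite derive1E -(derive_cst (0 : R) x 1).
apply: near_eq_derive.
have oab : open (~` `[a, b]%classic) by exact/closed_openC/interval_closed.
have : \near x, (~` `[a, b]%classic) x by apply: open_nbhs_nbhs; split => //=; exact/negP.
by apply: filterS => y /= /negP /f0.
Qed.

Lemma Rintegral_setT_vanish (R : realType) (f : R -> R) (a b : R) :
  (forall x, x \notin `[a, b] -> f x = 0) ->
  \int[@lebesgue_measure R]_x f x = \int[@lebesgue_measure R]_(x in `[a, b]) f x.
Proof.
move=> f0; rewrite [RHS]Rintegral_mkcond; apply: eq_Rintegral => x _.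
rewrite patchE; case: ifPn => // /negP xab; apply: f0; apply/negP => xab'.
by apply: xab; rewrite inE.
Qed.

Lemma Rintegral_by_parts_vanish (R : realType) (F G : R -> R) (a b : R) :
  a <= b -> classC 1 setT F -> classC 1 setT G ->
  (forall x, x \notin `[a, b] -> G x = 0) ->
  \int[@lebesgue_measure R]_x (F x * derive1 G x) =
  - \int[@lebesgue_measure R]_x (derive1 F x * G x).
Proof.
move=> ab CF CG G0.
(* On the interval enlarged by 1 on each side, [G] vanishes at both endpoints, so the boundary terms
   drop out. *)
have ab1 : a - 1 < b + 1 by lra.
have out x : x \notin `[a - 1, b + 1] -> x \notin `[a, b].
  by apply: contraNN; rewrite !in_itv/= => /andP[? ?]; apply/andP; split; lra.
have Ga : G (a - 1) = 0 by apply: G0; rewrite in_itv/= negb_and; apply/orP; left; lra.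
have Gb : G (b + 1) = 0 by apply: G0; rewrite in_itv/= negb_and; apply/orP; right; lra.
rewrite (@Rintegral_setT_vanish _ (fun x => F x * derive1 G x) (a - 1) (b + 1)); last first.
  by move=> x /out xab; rewrite (derive1_vanish G0 xab) mulr0.
rewrite (@Rintegral_setT_vanish _ (fun x => derive1 F x * G x) (a - 1) (b + 1)); last first.
  by move=> x /out xab; rewrite (G0 _ xab) mulr0.
have LR H : classC 1 setT H -> derivable_oo_LRcontinuous H (a - 1) (b + 1).
  move=> CH; have cH := classC_continuous CH; split.
  - by move=> x _; case: (classC_is_derive x CH).
  - by apply: cvg_at_right_filter; exact: cH.
  - by apply: cvg_at_left_filter; exact: cH.
rewrite (@Rintegration_by_parts _ F G (derive1 F) (derive1 G))//; last 4 first.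
- by apply: continuous_subspaceT; exact: classC_continuous (classC_derive1 CF).
- exact: LR.
- by apply: continuous_subspaceT; exact: classC_continuous (classC_derive1 CG).
- exact: LR.
by rewrite Ga Gb !mulr0 subrr sub0r.
Qed.

Lemma Rintegral_derive1n_vanish (R : realType) j (f phi : R -> R) (a b : R) :
  a <= b -> classC j setT f -> classC j setT phi ->
  (forall x, x \notin `[a, b] -> phi x = 0) ->
  \int[@lebesgue_measure R]_x (f x * derive1n j phi x) =
  (-1) ^+ j * \int[@lebesgue_measure R]_x (derive1n j f x * phi x).
Proof.
move=> ab; elim: j f phi => [|j IH] f phi Cf Cphi phi0; first by rewrite expr0 mul1r.
under eq_Rintegral do rewrite derive1Sn.
rewrite IH; [|exact: classCW|exact: classC_derive1|exact: derive1_vanish].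
rewrite (Rintegral_by_parts_vanish ab _ _ phi0).
- by rewrite exprSr -mulrA mulN1r.
- by apply: (@classC_derive1n _ 1 j); rewrite addn1.
- elim: j Cphi {IH Cf} => // j IHj; move=> /classCW; exact: IHj.
Qed.

(** * From weak derivatives to pointwise bounds on classical ones *)

Lemma lebesgue_measureT_gt0 (R : realType) : (0 < @lebesgue_measure R setT)%E.
Proof.
by rewrite -set_itvNyy lebesgue_measure_itv/= ltry.
Qed.

Lemma Linfty_ae_bounded (R : realType) (g : R -> R) : Linfty g ->
  measurable_fun setT g /\
  exists2 M : R, 0 <= M & {ae @lebesgue_measure R, forall x, `|g x| <= M}.
Proof.
rewrite /Linfty => gL; have mg := sub_Lfun_mfun gL; have gf := sub_Lfun_finLfun gL.
split; first by rewrite inE in mg.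
move: gf; rewrite inE /finite_norm unlock /Lnorm.
rewrite lebesgue_measureT_gt0 => goo.
(* The maximum with 0 makes the bound nonnegative and spares a separate treatment of -oo. *)
have le_max0 (e : \bar R) : (e < +oo -> e <= (Num.max (fine e) 0)%:E)%E.
  by case: e => [r _||_] //=; rewrite ?lee_fin ?le_max ?lexx ?leNye.
exists (Num.max (fine (ess_sup (@lebesgue_measure R) (abse \o (EFin \o g)))) 0).
  by rewrite le_max lexx orbT.
apply: filterS (ess_sup_ge (@lebesgue_measure R) (abse \o (EFin \o g))) => x gx.
by rewrite -lee_fin; apply: (le_trans gx); exact: le_max0.
Qed.

Lemma continuous_integrable_itv (R : realType) (f : R -> R) (a b : R) :
  continuous f -> (@lebesgue_measure R).-integrable `[a, b] (EFin \o f).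
Proof.
move=> cf; apply: continuous_compact_integrable; first exact: segment_compact.
exact: continuous_subspaceT.
Qed.

(** Since [f] may vanish at [a] and [b], as bumps do, the integral is compared with the one over the
    middle third, where the minimum of [f] is positive. *)
Lemma Rintegral_gt0 (R : realType) (f : R -> R) (a b : R) : a < b ->
  continuous f -> (forall x, 0 <= f x) -> (forall x, a < x < b -> 0 < f x) ->
  0 < \int[@lebesgue_measure R]_(x in `[a, b]) f x.
Proof.
move=> ab cf f0 fgt0.
pose c := (a + a + b) / 3; pose d := (a + b + b) / 3.
have cd : c < d by rewrite /c /d; lra.
have sub : `[c, d]%classic `<=` `[a, b]%classic.
  by move=> x /=; rewrite !in_itv/= /c /d => /andP[? ?]; apply/andP; split; lra.
have [m mcd mf] := EVT_min (ltW cd) (continuous_subspaceT cf).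
have fm0 : 0 < f m.
  apply: fgt0; move: mcd; rewrite in_itv/= /c /d => /andP[? ?].
  by apply/andP; split; lra.
apply: (@lt_le_trans _ _ (\int[@lebesgue_measure R]_(x in `[c, d]) f m)).
  rewrite Rintegral_cst//= lebesgue_measure_itv/= lte_fin cd/= mulr_gt0//.
  by rewrite subr_gt0.
apply: (@le_trans _ _ (\int[@lebesgue_measure R]_(x in `[c, d]) f x)).
  apply: le_Rintegral => //.
  - by apply: (@continuous_integrable_itv _ (cst (f m))) => x; exact: cst_continuous.
  - exact: continuous_integrable_itv.
rewrite /Rintegral fine_le//.
- by apply: integrable_fin_num => //; exact: continuous_integrable_itv.
- by apply: integrable_fin_num => //; exact: continuous_integrable_itv.
apply: ge0_subset_integral => //.
- have /integrableP[//] := @continuous_integrable_itv _ f a b cf.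
- by move=> x _; rewrite lee_fin.
Qed.

Lemma normr_Rintegral_le_ae (R : realType) (g phi : R -> R) (M a b : R) :
  0 <= M -> measurable_fun setT g ->
  {ae @lebesgue_measure R, forall x, `|g x| <= M} ->
  continuous phi -> (forall x, 0 <= phi x) ->
  `|\int[@lebesgue_measure R]_(x in `[a, b]) (g x * phi x)| <=
  M * \int[@lebesgue_measure R]_(x in `[a, b]) phi x.
Proof.
move=> M0 mg gM cphi phi0.
have iphi := @continuous_integrable_itv _ phi a b cphi.
have mphi : measurable_fun setT phi by exact: continuous_measurable_fun.
have mgphi : measurable_fun `[a, b] (fun x => (g x * phi x)%:E).
  by apply/measurable_EFinP; apply: measurable_funTS; exact: measurable_funM.
rewrite -RintegralZl//.
have iM : (@lebesgue_measure R).-integrable `[a, b] (EFin \o (fun x => M * phi x)).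
  apply: continuous_integrable_itv => x; apply: continuousM; last exact: cphi.
  exact: cst_continuous.
have fM : (\int[@lebesgue_measure R]_(x in `[a, b]) (M * phi x)%:E)%E \is a fin_num.
  exact: integrable_fin_num.
(* The inequality is proved first in the extended reals: it also yields the finiteness of the
   left-hand integral, without which [fine] would not be monotone. *)
suff H : (`|\int[@lebesgue_measure R]_(x in `[a, b]) (g x * phi x)%:E| <=
     \int[@lebesgue_measure R]_(x in `[a, b]) (M * phi x)%:E)%E.
  have fg : (\int[@lebesgue_measure R]_(x in `[a, b]) (g x * phi x)%:E)%E \is a fin_num.
    rewrite fin_num_abs (le_lt_trans H)// -ge0_fin_numE// integral_ge0// => x _.
    by rewrite lee_fin mulr_ge0.
  by rewrite /Rintegral -fine_abse// fine_le// abse_fin_num.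
apply: le_trans; first by apply: le_abse_integral => //; exact: mgphi.
apply: ae_ge0_le_integral => //.
- by apply: measurableT_comp.
- by move=> x _; rewrite lee_fin mulr_ge0.
- have /integrableP[//] := iM.
- case: gM => N [mN N0 HN]; exists N; split => // x /= Hx; apply: HN => /= gx.
  by apply: Hx => _; rewrite lee_fin normrM (ger0_norm (phi0 x)) ler_wpM2r.
Qed.

(** If the classical derivative exceeded [M + 1] in absolute value at [x0], with [M] an almost
    everywhere bound of [g], it would by continuity do so with a constant sign near [x0]. Testing
    against a bump [phi] supported there would give that [(M + 1)] times the integral of [phi] is at
    most [M] times it, although this integral is positive. *)
Lemma weak_derivative_bounded (R : realType) j (f : R -> R) :
  classC j setT f -> (exists2 g, Linfty g & weak_derivative j f g) ->
  exists M : R, forall x : R, `|derive1n j f x| <= M.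
Proof.
move=> Cf [g /Linfty_ae_bounded[mg [M M0 gM]] wg].
set F := derive1n j f.
have cF : continuous F.
  by apply: (@classC_continuous _ 0); apply: classC_derive1n; rewrite addn0.
exists (M + 1) => x0; rewrite leNgt; apply/negP => Fx0.
pose c : R := Num.sg (F x0).
have cG : continuous (fun x : R => c * F x : R).
  move=> x. apply: (@continuousM _ _ (cst c) F); [exact: cst_continuous|exact: cF].
have : \near x0, M + 1 < c * F x0.
  by apply: (cvgr_gt (c * F x0) (cG x0)); rewrite -normrEsg.
move=> [e /= e0 He].
(* Half the radius keeps the closed interval inside the open ball of radius [e]. *)
pose a := x0 - e / 2; pose b := x0 + e / 2.
have ab : a < b by rewrite /a /b; lra.
have HF x : x \in `[a, b] -> M + 1 < c * F x.
  rewrite in_itv/= /a /b => /andP[? ?]; apply: He => /=.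
  by rewrite ltr_distlC; apply/andP; split; lra.
have [Cphi _] := test_function_bump a b.
set phi := bump a b in Cphi.
have cphi : continuous phi := classC_continuous (Cphi 0%N).
have phi0 := @bump_out R a b.
have I0 : 0 < \int[@lebesgue_measure R]_(x in `[a, b]) phi x.
  by apply: Rintegral_gt0 => // x; [exact: bump_ge0|exact: bump_gt0].
have vanM h : forall x, x \notin `[a, b] -> h x * phi x = 0.
  by move=> x /phi0 px; rewrite /phi px mulr0.
have E1 : \int[@lebesgue_measure R]_(x in `[a, b]) (F x * phi x) =
          \int[@lebesgue_measure R]_(x in `[a, b]) (g x * phi x).
  have := wg phi (test_function_bump a b).
  rewrite (Rintegral_derive1n_vanish (ltW ab) Cf (Cphi j) phi0).
  rewrite (Rintegral_setT_vanish (vanM (derive1n j f))) (Rintegral_setT_vanish (vanM g)).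
  by move=> /mulfI; apply; rewrite signr_eq0.
have iF : (@lebesgue_measure R).-integrable `[a, b] (EFin \o (fun x => F x * phi x)).
  by apply: continuous_integrable_itv => x; apply: continuousM; [exact: cF|exact: cphi].
have E2 : (M + 1) * \int[@lebesgue_measure R]_(x in `[a, b]) phi x <=
  c * \int[@lebesgue_measure R]_(x in `[a, b]) (F x * phi x).
  rewrite -!RintegralZl//; last exact: continuous_integrable_itv.
  apply: le_Rintegral => //.
  - apply: continuous_integrable_itv => x.
    apply: (@continuousM _ _ (cst (M + 1)) phi); last exact: cphi.
    exact: cst_continuous.
  - apply: continuous_integrable_itv => x.
    apply: (@continuousM _ _ (cst c) (fun x => F x * phi x)).
      exact: cst_continuous.
    by apply: continuousM; [exact: cF|exact: cphi].
  - move=> x xab; rewrite mulrA ler_wpM2r ?bump_ge0// ltW//.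
    exact: HF.
have E3 := normr_Rintegral_le_ae a b M0 mg gM cphi (@bump_ge0 R a b).
rewrite -E1 in E3.
have c1 : `|c| <= 1 by rewrite normr_sg; case: (_ == _).
have : (M + 1) * \int[@lebesgue_measure R]_(x in `[a, b]) phi x <=
       M * \int[@lebesgue_measure R]_(x in `[a, b]) phi x.
  apply: (le_trans E2); apply: le_trans E3; rewrite (le_trans (ler_norm _))//.
  by rewrite normrM ler_piMl.
by rewrite ler_pM2r// gerDl ler10.
Qed.

(** * Inverting the characteristic map [z + a * w z] *)

(** Subtract the relation at [t] from the one at [s] and write the increments of [al], [be], [w]
    with Caratheodory slopes: [Z s - Z t] times [den s] equals a continuous function times [s - t],
    and [den] is nonzero near [t]. *)
Lemma is_derive_implicit (R : realType) (Z al be w : R -> R) (t dal dbe dw : R) :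
  (\near t, Z t + al t * w (Z t) = be t) -> {for t, continuous Z} ->
  is_derive t 1 al dal -> is_derive t 1 be dbe -> is_derive (Z t) 1 w dw ->
  1 + al t * dw != 0 ->
  is_derive t 1 Z ((dbe - dal * w (Z t)) / (1 + al t * dw)).
Proof.
move=> ZE cZ Dal Dbe Dw n0.
have cal := is_derive_continuous Dal.
move: Dal Dbe Dw => /is_derive1_caratheodory[qa [qaE cqa qat]].
move=> /is_derive1_caratheodory[qb [qbE cqb qbt]].
move=> /is_derive1_caratheodory[qw [qwE cqw qwt]].
pose den s := 1 + al s * qw (Z s).
have cden : {for t, continuous den}.
  apply: cvgD; first exact: cvg_cst.
  by apply: cvgM => //; exact: (@continuous_comp _ _ _ Z qw).
have dent : den t = 1 + al t * dw by rewrite /den qwt.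
have den0 : \near t, den t != 0 by apply: cvgr_neq0 cden _; rewrite dent.
pose q s := (qb s - qa s * w (Z t)) / den s.
have ZtE := nbhs_singleton ZE.
(* The Caratheodory criterion asks for a global identity, while the relation holds only near [t];
   hence this substitute, which agrees with [Z] there. *)
apply: (@near_eq_is_derive _ R R (fun s => Z t + q s * (s - t))).
  near=> s.
  have ds : den s != 0 by near: s.
  have Es : Z s + al s * w (Z s) = be s by near: s.
  have key : (Z s - Z t) * den s = (qb s - qa s * w (Z t)) * (s - t).
    rewrite [RHS]mulrBl mulrAC -qbE -qaE -Es -ZtE /den mulrDr mulr1 mulrCA.
    by rewrite [_ * qw _]mulrC -qwE; ring.
  by rewrite /q mulrAC -key mulfK//; ring.
apply/is_derive1_caratheodory; exists q; split.
- by move=> s; rewrite subrr mulr0 addr0; ring.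
- apply: cvgM; last by apply: cvgV => //; rewrite dent.
  by apply: cvgB => //; apply: cvgM => //; exact: cvg_cst.
- by rewrite /q qbt qat dent.
Unshelve. all: by end_near. Qed.

Lemma characteristic_expansive (R : realType) (w : R -> R) (a c x y : R) :
  classC 1 setT w -> (forall z : R, c <= 1 + a * derive1 w z) -> x <= y ->
  c * (y - x) <= (y + a * w y) - (x + a * w x).
Proof.
move=> Cw Hc xy.
have D (z : R) : is_derive z 1 (fun z : R => z + a * w z) (1 + a * derive1 w z).
  exact: (is_deriveD (is_derive_id z 1) (is_deriveZ a (classC_is_derive z Cw))).
have [|d _ ->] := @MVT_segment _ _ _ x y xy (fun z _ => D z).
  by apply: continuous_subspaceT => z; exact: is_derive_continuous (D z).
by rewrite ler_wpM2r// subr_ge0.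
Qed.

Lemma normr_characteristic (R : realType) (w : R -> R) (a c x y : R) :
  classC 1 setT w -> (forall z : R, c <= 1 + a * derive1 w z) ->
  c * `|x - y| <= `|(x + a * w x) - (y + a * w y)|.
Proof.
move=> Cw Hc; wlog xy : x y / x <= y.
  move=> H; have [/H//|/ltW/H] := leP x y.
  by rewrite distrC [X in _ <= X -> _]distrC.
rewrite distrC [X in _ <= X]distrC ger0_norm ?subr_ge0//.
by apply: le_trans (ler_norm _); exact: characteristic_expansive.
Qed.

(** The map expands distances by at least [c], so moving by [r] from 0 in either direction shifts
    its value by at least the distance from [F 0] to [y]. The intermediate value theorem on
    [[-r, r]] then applies. *)
Lemma characteristic_surj (R : realType) (w : R -> R) (a c y : R) : 0 < c ->
  classC 1 setT w -> (forall z : R, c <= 1 + a * derive1 w z) ->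
  exists z, z + a * w z = y.
Proof.
move=> c0 Cw Hc; pose F z := z + a * w z.
have cF : continuous F.
  move=> z; apply: cvgD; first exact: cvg_id.
  by apply: cvgM; [exact: cvg_cst|exact: (classC_continuous Cw)].
pose r := `|y - F 0| / c.
have r0 : 0 <= r by rewrite divr_ge0// ltW.
have cr : c * r = `|y - F 0| by rewrite /r mulrC divfK// gt_eqF.
have up := characteristic_expansive Cw Hc r0.
have dn : - r <= 0 by rewrite oppr_le0.
have {}dn := characteristic_expansive Cw Hc dn.
rewrite -/(F 0) -/(F _) subr0 cr in up; rewrite -/(F 0) -/(F _) sub0r opprK cr in dn.
have := ler_norm (y - F 0); have := ler_norm (- (y - F 0)); rewrite normrN => h1 h2.
have rr : - r <= r by rewrite (le_trans _ r0)// oppr_le0.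
have [|z _ zy] := @IVT _ F (- r) r y rr (continuous_subspaceT cF).
  have Frr : F (- r) <= F r by lra.
  by rewrite min_l// max_r//; apply/andP; split; lra.
by exists z.
Qed.

(* The foot at parameter 0 of the characteristic through (a, y), and 0 if there is
   none. *)
Definition foot (R : realType) (w : R -> R) (a y : R) : R :=
  xget 0 [set z | z + a * w z = y].

Lemma footP (R : realType) (w : R -> R) (a c y : R) : 0 < c ->
  classC 1 setT w -> (forall z : R, c <= 1 + a * derive1 w z) ->
  foot w a y + a * w (foot w a y) = y.
Proof.
move=> c0 Cw Hc; have [z zy] := characteristic_surj y c0 Cw Hc.
by rewrite /foot; case: xgetP => [u -> //|/(_ z)].
Qed.

(** Keep the foot [z] at [(a, y)] fixed. The residual [z + p.1 * w z - p.2] is continuous in [p] and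
    vanishes at [(a, y)]; expansiveness bounds [c] times the displacement of the foot by this
    residual. *)
Lemma continuous_foot (R : realType) (w : R -> R) (lo hi c a y : R) : 0 < c ->
  classC 1 setT w -> (forall b z : R, lo < b < hi -> c <= 1 + b * derive1 w z) ->
  lo < a < hi -> {for (a, y), continuous (fun p : R * R => foot w p.1 p.2)}.
Proof.
move=> c0 Cw Hc aI; set z := foot w a y.
have zE : z + a * w z = y by apply: (footP _ c0 Cw) => u; exact: Hc.
apply/cvgrPdist_le => e e0 /=; rewrite -/z.
have c1 : {for (a, y), continuous (fun p : R * R => p.1)} by exact: cvg_fst.
have c2 : {for (a, y), continuous (fun p : R * R => p.2)} by exact: cvg_snd.
have ch : {for (a, y), continuous (fun p : R * R => z + p.1 * w z - p.2)}.
  apply: cvgB => //; apply: cvgD; first exact: cvg_cst.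
  by apply: cvgM => //; exact: cvg_cst.
have ec : 0 < e * c by rewrite mulr_gt0.
move/cvgrPdist_lt: ch => /(_ _ ec) /=; rewrite zE subrr => ch.
have [lo_a a_hi] := andP aI.
near=> p.
have pI : lo < p.1 < hi.
  apply/andP; split; near: p; [exact: cvgr_gt c1 _ lo_a|exact: cvgr_lt c1 _ a_hi].
have : `|0 - (z + p.1 * w z - p.2)| < e * c by near: p.
rewrite sub0r normrN -[in X in X < _ -> _](footP p.2 c0 Cw (fun u => Hc _ u pI)).
move=> H; have := normr_characteristic z (foot w p.1 p.2) Cw (fun u => Hc _ u pI).
by move=> /le_lt_trans/(_ H); rewrite mulrC ltr_pM2r// => /ltW.
Unshelve. all: by end_near. Qed.

(** The foot is followed along an arbitrary curve [(al, be)], so that one statement serves for the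
    derivatives in time, in space and in the parameter [a] alone. *)
Lemma is_derive_foot (R : realType) (w al be : R -> R) (lo hi c t dal dbe : R) :
  0 < c -> classC 1 setT w ->
  (forall b z : R, lo < b < hi -> c <= 1 + b * derive1 w z) -> lo < al t < hi ->
  is_derive t 1 al dal -> is_derive t 1 be dbe ->
  let z := foot w (al t) (be t) in
  is_derive t 1 (fun s => foot w (al s) (be s))
    ((dbe - dal * w z) / (1 + al t * derive1 w z)).
Proof.
move=> c0 Cw Hc alI Dal Dbe z.
have cal := is_derive_continuous Dal; have cbe := is_derive_continuous Dbe.
have [lo_a a_hi] := andP alI.
apply: (is_derive_implicit (Z := fun s => foot w (al s) (be s)) _ _ Dal Dbe
  (classC_is_derive z Cw)).
- near=> s; apply: (footP _ c0 Cw) => u; apply: Hc; apply/andP; split; near: s.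
    exact: cvgr_gt cal _ lo_a.
  exact: cvgr_lt cal _ a_hi.
- apply: (@continuous_comp _ _ _ (fun s => (al s, be s)) (fun p => foot w p.1 p.2)).
    exact: (cvg_pair cal cbe).
  exact: (continuous_foot c0 Cw Hc alI).
- by rewrite gt_eqF// (lt_le_trans c0)//; exact: Hc.
Unshelve. all: by end_near. Qed.

(** * Regularity on the closed half plane *)

Lemma bounded_continuous_Linfty (R : realType) (f : R -> R) (C : R) :
  continuous f -> (forall x, `|f x| <= C) -> Linfty f.
Proof.
move=> cf fC; rewrite /Linfty; apply/andP; split.
  by rewrite inE; exact: continuous_measurable_fun.
rewrite inE /finite_norm unlock /Lnorm lebesgue_measureT_gt0.
apply: (@le_lt_trans _ _ C%:E); last exact: ltry.
by apply/ess_supP; apply: nearW => x /=; rewrite lee_fin.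
Qed.

(** Right neighbours of [t] are admissible times even at [t = 0]. Properness gives uniqueness of the
    limit that defines [d_t]. *)
Lemma proper_time_filter (R : realType) (t : R) : 0 <= t ->
  ProperFilter (within [set s : R | 0 <= s] t^').
Proof.
move=> t0; apply: Build_ProperFilter_ex => P PF.
near t^'+ => s.
exists s; have ts : t < s by near: s; exact: nbhs_right_gt.
suff: 0 <= s -> P s by apply; rewrite (le_trans t0)// ltW.
near: s.
have : \forall s \near t^', 0 <= s -> P s by exact: PF.
rewrite /at_right !near_withinE; apply: filterS => s H ts0.
by apply: H; rewrite gt_eqF.
Unshelve. all: by end_near. Qed.

Lemma time_quotient_cvg (R : realType) (u : R -> R -> R) (t x d : R) :
  is_derive t 1 (u^~ x) d -> time_quotient u t x --> d.
Proof.
move=> /is_derive1_caratheodory[q [qE cq qt]].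
have H : q s @[s --> t^'] --> d by rewrite -qt; exact/continuous_withinNx.
apply: (@cvg_trans _ (q s @[s --> within [set s | 0 <= s] t^'])); last first.
  by apply: cvg_trans H; apply: cvg_app; exact: cvg_within.
apply: near_eq_cvg; apply: cvg_within; near=> s.
have st : s - t != 0 by rewrite subr_eq0; near: s; exact: nbhs_dnbhs_neq.
by rewrite qE mulfK.
Unshelve. all: by end_near. Qed.

Lemma C1_half_planeP (R : realType) (u ut ux : R -> R -> R) :
  (forall t x : R, 0 <= t -> is_derive t 1 (u^~ x) (ut t x)) ->
  (forall t x : R, 0 <= t -> is_derive x 1 (u t) (ux t x)) ->
  (forall t x : R, 0 <= t -> {for (t, x), continuous (fun p : R * R => u p.1 p.2)}) ->
  (forall t x : R, 0 <= t -> {for (t, x), continuous (fun p : R * R => ut p.1 p.2)}) ->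
  (forall t x : R, 0 <= t -> {for (t, x), continuous (fun p : R * R => ux p.1 p.2)}) ->
  [/\ C1_half_plane u, forall t x : R, 0 <= t -> d_t u t x = ut t x &
      forall t x : R, 0 <= t -> d_x u t x = ux t x].
Proof.
move=> Dt Dx cu cut cux.
have tE (t x : R) : 0 <= t -> d_t u t x = ut t x.
  move=> t0; have := proper_time_filter t0 => ?.
  exact: (cvg_lim _ (time_quotient_cvg (Dt t x t0))).
have xE (t x : R) : 0 <= t -> d_x u t x = ux t x.
  by move=> t0; rewrite /d_x derive1E; have [_ ->] := Dx t x t0.
(* [d_t u] and [d_x u] agree with the formulas [ut] and [ux] only for nonnegative times, so
   continuity is transferred within the half plane. *)
have within_eq (g k : R -> R -> R) :
    (forall t x : R, 0 <= t -> g t x = k t x) ->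
    (forall t x : R, 0 <= t -> {for (t, x), continuous (fun p : R * R => k p.1 p.2)}) ->
    {within @half_plane R, continuous (fun p : R * R => g p.1 p.2)}.
  move=> gk ck; apply/subspace_continuousP => -[t x] /= t0.
  have := ck t x t0; rewrite /prop_for /continuous_at/= -(gk t x t0) => ckt.
  apply: (@cvg_trans _ ((fun p => k p.1 p.2) @ within (@half_plane R) (nbhs (t, x)))).
    apply: near_eq_cvg; rewrite near_withinE; apply: nearW => -[s y] /= s0.
    by rewrite /from_subspace/= gk.
  by apply: cvg_trans ckt; apply: cvg_app; exact: cvg_within.
split=> //; split.
- by move=> t x t0; apply/cvg_ex; exists (ut t x); exact: time_quotient_cvg (Dt t x t0).
- by move=> t x t0; case: (Dx t x t0).
- exact: within_eq.
- exact: within_eq tE cut.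
- exact: within_eq xE cux.
Qed.

(** * The density as a function of the characteristic parameter *)

(** Mass between neighbouring characteristics is conserved, hence the division by the Jacobian of
    [z + a * w z]. *)
Definition density (R : realType) (r w : R -> R) (a y : R) : R :=
  r (foot w a y) / (1 + a * derive1 w (foot w a y)).

Lemma is_derive_jacobian_quotient (R : realType) (r w al Z : R -> R) (t dal dZ : R) :
  classC 1 setT r -> classC 2 setT w ->
  is_derive t 1 al dal -> is_derive t 1 Z dZ ->
  let z := Z t in let J := 1 + al t * derive1 w z in J != 0 ->
  is_derive t 1 (fun s => r (Z s) / (1 + al s * derive1 w (Z s)))
    (derive1 r z * dZ / J -
     r z * (dal * derive1 w z + al t * (derive1n 2 w z * dZ)) / J ^+ 2).
Proof.
move=> Cr Cw Dal DZ z J J0.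
have Dr := @is_derive1_comp _ r Z t _ _ (classC_is_derive z Cr) DZ.
have Dw' : is_derive t 1 (derive1 w \o Z) (derive1n 2 w z * dZ).
  exact: (is_derive1_comp (classC_is_derive z (classC_derive1 Cw)) DZ).
have DJ := is_deriveD (is_derive_cst (1 : R) t 1) (is_deriveM Dal Dw').
have DJV := @is_deriveV _ (cst 1 + al * (derive1 w \o Z)) t _ _ J0 DJ.
apply: is_derive_eq (is_deriveM Dr DJV) _.
by rewrite /GRing.scale/= -/z add0r -[(cst 1 + _) t]/J; field.
Qed.

Lemma density_lipschitz (R : realType) (r w : R -> R) (lo hi c : R) : 0 < c ->
  classC 1 setT r -> classC 2 setT w ->
  (forall b z : R, lo < b < hi -> c <= 1 + b * derive1 w z) ->
  (exists B : R, forall z : R, `|r z| <= B) -> (exists B : R, forall z : R, `|derive1 r z| <= B) ->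
  (exists B : R, forall z : R, `|w z| <= B) -> (exists B : R, forall z : R, `|derive1 w z| <= B) ->
  (exists B : R, forall z : R, `|derive1n 2 w z| <= B) ->
  exists K : R, forall a b y : R, lo < a -> a <= b -> b < hi ->
    `|density r w b y - density r w a y| <= K * (b - a).
Proof.
move=> c0 Cr Cw Hc [B0 rB] [B1 r'B] [W0 wB] [W1 w'B] [W2 w''B].
have Cw1 := classCW Cw.
pose H := Num.max `|lo| `|hi|.
(* This bounds the derivative [D] of the density in the parameter term by term: [W0 / c] bounds the
   speed [dZ] of the foot, [c] the Jacobian from below, and [H] the parameter itself. *)
exists (B1 * (W0 / c) / c + B0 * (W1 + H * (W2 * (W0 / c))) / c ^+ 2) => a b y la ab bh.
pose dZ s := (0 - 1 * w (foot w s y)) / (1 + s * derive1 w (foot w s y)).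
pose D s := derive1 r (foot w s y) * dZ s / (1 + s * derive1 w (foot w s y)) -
     r (foot w s y) * (1 * derive1 w (foot w s y) + s * (derive1n 2 w (foot w s y) * dZ s))
     / (1 + s * derive1 w (foot w s y)) ^+ 2.
have DD s : lo < s < hi -> is_derive s 1 (density r w ^~ y) (D s).
  move=> sI.
  have DZ := is_derive_foot (al := id) (be := cst y) c0 Cw1 Hc sI (is_derive_id s 1)
    (is_derive_cst y s 1).
  apply: (is_derive_jacobian_quotient Cr Cw (is_derive_id s 1) DZ).
  by rewrite gt_eqF// (lt_le_trans c0)//; exact: Hc.
have sub s : s \in `[a, b] -> lo < s < hi.
  by rewrite in_itv/= => /andP[sa sb]; apply/andP; split; lra.
have [s sab||s sab ->] := @MVT_segment _ (density r w ^~ y) D a b ab.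
- by apply: DD; apply: sub; exact: subset_itv_oo_cc sab.
- apply: derivable_within_continuous => s sab.
  by have [] := DD s (sub s sab).
rewrite normrM [`|b - a|]ger0_norm ?subr_ge0//; apply: ler_wpM2r; first by rewrite subr_ge0.
have sI := sub _ sab.
pose z := foot w s y; pose J := 1 + s * derive1 w z.
have cJ : c <= `|J| by apply: le_trans (ler_norm _); exact: Hc.
have J0 : 0 < `|J| := lt_le_trans c0 cJ.
have JV : `|J|^-1 <= c^-1 by rewrite lef_pV2.
have JVc n : `|J ^- n| <= c ^- n.
  by rewrite normfV normrX -!exprVn lerXn2r// ?nnegrE ?invr_ge0// ltW.
have c20 : 0 <= c ^- 2 by rewrite invr_ge0 exprn_ge0// ltW.
have cV0 : 0 <= c^-1 by rewrite invr_ge0 ltW.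
have hdZ : `|dZ s| <= W0 / c.
  rewrite /dZ -/z -/J sub0r mul1r normrM normrN; apply: ler_pM => //.
  by rewrite normfV.
have sH : `|s| <= H.
  rewrite /H le_max !ler_norml; have [? ?] := andP sI.
  have := ler_norm (- lo); have := ler_norm hi; rewrite normrN => ? ?.
  have [s0|s0] := leP 0 s; apply/orP; [right|left]; apply/andP; split; lra.
rewrite /D -/z -/J; move: (dZ s) hdZ => dz hdz.
apply: (le_trans (ler_normB _ _)); apply: lerD.
  rewrite !normrM; apply: ler_pM => //.
    exact: ler_pM.
  by rewrite normfV.
rewrite !normrM; apply: ler_pM => //.
apply: ler_pM => //; apply: (le_trans (ler_normD _ _)); apply: lerD.
  by rewrite mul1r.
by rewrite !normrM; apply: ler_pM => //; exact: ler_pM.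
Qed.

(* An open window around [0, A] makes all time derivatives two-sided, including
   those at t = 0. *)
Lemma jacobian_window (R : realType) (p : R -> R) (A k M : R) :
  0 < A -> 0 < k -> (forall z, `|p z| <= M) ->
  (forall a z : R, 0 <= a <= A -> k <= 1 + a * p z) ->
  exists lo hi c : R, [/\ lo < 0, A < hi, 0 < c &
    forall b z : R, lo < b < hi -> c <= 1 + b * p z].
Proof.
move=> A0 k0 pM kp.
have M0 : 0 <= M := le_trans (normr_ge0 _) (pM 0).
(* Chosen so that [d * M <= k / 2]; [M + 1] avoids a division by zero when [M = 0]. *)
pose d := k / (2 * (M + 1)).
have M1 : 0 < 2 * (M + 1) by lra.
have d0 : 0 < d by rewrite divr_gt0.
have dM : d * M <= k / 2.
  have : d * (2 * (M + 1)) = k by rewrite /d divfK// gt_eqF.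
  by move=> <-; lra.
exists (- d), (A + d), (k / 2); split; [by rewrite oppr_lt0|by rewrite ltrDl|lra|].
move=> b z /andP[db bA].
have := pM z; rewrite ler_norml => /andP[pl pu].
have k1 : k <= 1 by have := kp 0 z; rewrite mul0r addr0 lexx ltW//; apply.
(* Leaving [[0, A]] by at most [d] costs at most [k / 2]. This is used with [b] when [b < 0], where
   [k <= 1] helps, and with [b - A] when [A < b]. *)
have small e : `|e| <= d -> - (k / 2) <= e * p z.
  move=> ed; rewrite lerNl (le_trans _ dM)// (le_trans (ler_norm _))//.
  by rewrite normrN normrM ler_pM.
have [b0|b0] := leP 0 b; last first.
  have := small b; rewrite ler0_norm ?(ltW b0)// => /(_ _); lra.
have [bA'|Ab] := leP b A.
  by have := kp b z; rewrite b0 bA' => /(_ isT); lra.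
have := small (b - A); rewrite ger0_norm ?subr_ge0 ?(ltW Ab)// => /(_ _).
have := kp A z; rewrite lexx ltW//= => /(_ isT); rewrite mulrBl; lra.
Qed.

(** * The explicit solution without pressure *)

(** For nonzero [om], the integral of [expR (- (om * s))] for s from 0 to [t]: the displacement in
    the moving frame per unit of initial deviation. *)
Definition relaxation_time (R : realType) (om t : R) : R := (1 - expR (- (om * t))) / om.

Lemma is_derive_expRN (R : realType) (om t : R) :
  is_derive t 1 (fun t : R => expR (- (om * t))) (- om * expR (- (om * t))).
Proof.
have D := is_deriveN (is_deriveZ om (is_derive_id t 1)).
apply: is_derive_eq (@is_derive1_comp _ expR _ t _ _ (is_derive_expR _) D) _.
by rewrite /GRing.scale/= mulr1 mulrC.
Qed.

Lemma is_derive_relaxation_time (R : realType) (om t : R) : om != 0 ->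
  is_derive t 1 (relaxation_time om) (expR (- (om * t))).
Proof.
move=> om0.
have D := is_deriveM (is_deriveB (is_derive_cst (1 : R) t 1) (is_derive_expRN om t))
  (is_derive_cst (om^-1) t 1).
apply: is_derive_eq D _.
by rewrite /GRing.scale/= mulr0 add0r sub0r; field.
Qed.

Lemma relaxation_time_itv (R : realType) (om t : R) : 0 < om -> 0 <= t ->
  0 <= relaxation_time om t <= om^-1.
Proof.
move=> om0 t0; have e0 := expR_gt0 (- (om * t)).
have e1 : expR (- (om * t)) <= 1 by rewrite -expR0 ler_expR oppr_le0 mulr_ge0// ltW.
apply/andP; split; first by rewrite divr_ge0 ?(ltW om0)//; lra.
by rewrite /relaxation_time ler_pdivrMr// mulVf ?gt_eqF//; lra.
Qed.

(** The Jacobian is at least [k] and [r] is at most [rb * k], so their quotient is at most [rb]. The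
    range of [a] includes [om^-1], the limit parameter, so that the profile [h] obeys the same
    bound. *)
Lemma relaxed_transport (R : realType) (om vs k rb : R) (r w : R -> R) :
  0 < om -> 0 < k -> classC 1 setT r -> classC 2 setT w ->
  (exists B : R, forall z : R, `|derive1 r z| <= B) ->
  (exists B : R, forall z : R, `|w z| <= B) -> (exists B : R, forall z : R, `|derive1 w z| <= B) ->
  (exists B : R, forall z : R, `|derive1n 2 w z| <= B) ->
  (forall a z : R, 0 <= a <= om^-1 -> k <= 1 + a * derive1 w z) ->
  (forall z : R, 0 < r z <= rb * k) ->
  exists rho v : R -> R -> R,
  [/\ C1_half_plane rho /\ C1_half_plane v,
      forall t x : R, 0 <= t ->
        [/\ 0 < rho t x <= rb,
            d_t rho t x + v t x * d_x rho t x + rho t x * d_x v t x = 0 &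
            d_t v t x + v t x * d_x v t x = - om * (v t x - vs)],
      forall x : R, rho 0 x = r x /\ v 0 x = vs + w x,
      forall t x : R, exists z : R, v t x - vs = expR (- (om * t)) * w z &
      exists h : R -> R, [/\ forall y : R, 0 < h y <= rb, classC 1 setT h &
        exists K : R, forall t x : R, 0 <= t ->
          `|rho t x - h (x - vs * t)| * expR (om * t) <= K]].
Proof.
move=> om0 k0 Cr Cw Br1 Bw Bw1 Bw2 Hk Hr.
have omn0 : om != 0 by rewrite gt_eqF.
have omV0 : 0 < om^-1 by rewrite invr_gt0.
have [M1 wM1] := Bw1.
have [lo [hi [c [lo0 hiA c0 Hc]]]] := jacobian_window omV0 k0 wM1 Hk.
have Cw1 := classCW Cw; have cw := classC_continuous Cw.
have cw' := classC_continuous (classC_derive1 Cw).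
have cw'' := classC_continuous (classC_derive1 (classC_derive1 Cw)).
have cr := classC_continuous Cr; have cr' := classC_continuous (classC_derive1 Cr).
pose e (t : R) : R := expR (- (om * t)).
pose al := relaxation_time om.
pose Z (t x : R) : R := foot w (al t) (x - vs * t).
pose J (t x : R) : R := 1 + al t * derive1 w (Z t x).
pose rho (t x : R) : R := density r w (al t) (x - vs * t).
pose v (t x : R) : R := vs + e t * w (Z t x).
have alI (t : R) : 0 <= t -> lo < al t < hi.
  by move=> /(relaxation_time_itv om0)/andP[? ?]; rewrite /al; apply/andP; split; lra.
have Jgt0 (t x : R) : 0 <= t -> J t x != 0.
  by move=> /alI aI; rewrite gt_eqF// (lt_le_trans c0)//; exact: Hc.
have Dal (t : R) : is_derive t 1 al (e t) by exact: is_derive_relaxation_time.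
have De (t : R) : is_derive t 1 e (- om * e t) by exact: is_derive_expRN.
have Dbt (t x : R) : is_derive t 1 (fun t : R => x - vs * t) (- vs).
  apply: is_derive_eq (is_deriveB (is_derive_cst x t 1)
    (is_deriveZ vs (is_derive_id t 1))) _.
  by rewrite /GRing.scale/= mulr1 sub0r.
have Dbx (t x : R) : is_derive x 1 (fun x : R => x - vs * t) 1.
  apply: is_derive_eq (is_deriveB (is_derive_id x 1) (is_derive_cst (vs * t) x 1)) _.
  by rewrite subr0.
(* These formulas, and [rt], [rx] below, keep the unsimplified shape produced by the derivative
   lemmas, zero factors included, so that those lemmas apply directly. *)
pose Zt (t x : R) : R := (- vs - e t * w (Z t x)) / J t x.
pose Zx (t x : R) : R := (1 - 0 * w (Z t x)) / J t x.
have DZt (t x : R) : 0 <= t -> is_derive t 1 (Z ^~ x) (Zt t x).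
  move=> /alI aI.
  exact: (is_derive_foot (be := fun t => x - vs * t) c0 Cw1 Hc aI (Dal t) (Dbt t x)).
have DZx (t x : R) : 0 <= t -> is_derive x 1 (Z t) (Zx t x).
  move=> /alI aI.
  exact: (is_derive_foot (al := cst (al t)) c0 Cw1 Hc aI (is_derive_cst _ x 1) (Dbx t x)).
pose rt (t x : R) : R := derive1 r (Z t x) * Zt t x / J t x - r (Z t x) *
  (e t * derive1 w (Z t x) + al t * (derive1n 2 w (Z t x) * Zt t x)) / J t x ^+ 2.
pose rx (t x : R) : R := derive1 r (Z t x) * Zx t x / J t x - r (Z t x) *
  (0 * derive1 w (Z t x) + al t * (derive1n 2 w (Z t x) * Zx t x)) / J t x ^+ 2.
pose vt (t x : R) : R := - om * e t * w (Z t x) + e t * (derive1 w (Z t x) * Zt t x).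
pose vx (t x : R) : R := e t * (derive1 w (Z t x) * Zx t x).
have Drt (t x : R) : 0 <= t -> is_derive t 1 (rho ^~ x) (rt t x).
  move=> t0; exact: (is_derive_jacobian_quotient Cr Cw (Dal t) (DZt t x t0) (Jgt0 t x t0)).
have Drx (t x : R) : 0 <= t -> is_derive x 1 (rho t) (rx t x).
  move=> t0; exact: (is_derive_jacobian_quotient Cr Cw (is_derive_cst (al t) x 1)
    (DZx t x t0) (Jgt0 t x t0)).
have DwZ (q : R -> R) (s dq : R) : is_derive s 1 q dq ->
    is_derive s 1 (w \o q) (derive1 w (q s) * dq).
  by move=> Dq; exact: (is_derive1_comp (classC_is_derive _ Cw) Dq).
have Dvt (t x : R) : 0 <= t -> is_derive t 1 (v ^~ x) (vt t x).
  move=> t0; apply: is_derive_eq (is_deriveD (is_derive_cst vs t 1)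
    (is_deriveM (De t) (DwZ _ _ _ (DZt t x t0)))) _.
  by rewrite /GRing.scale/= add0r addrC mulrC.
have Dvx (t x : R) : 0 <= t -> is_derive x 1 (v t) (vx t x).
  move=> t0; apply: is_derive_eq (is_deriveD (is_derive_cst vs x 1)
    (is_deriveZ (e t) (DwZ _ _ _ (DZx t x t0)))) _.
  by rewrite /GRing.scale/= add0r.
(* The constant [c] of the enlarged window only serves differentiability and the Lipschitz estimate;
   the bound by [rb] needs the original constant [k]. *)
have Jk (t x : R) : 0 <= t -> k <= J t x by move=> t0; apply: Hk; exact: relaxation_time_itv.
have rb_bound z j : k <= j -> 0 < r z / j <= rb.
  move=> kj; have j0 := lt_le_trans k0 kj; have /andP[r0 rk] := Hr z.
  have rb0 : 0 <= rb by rewrite -(pmulr_lge0 _ k0) (le_trans (ltW r0)).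
  rewrite divr_gt0//= ler_pdivrMr// (le_trans rk)// ler_wpM2l//.
pose h := density r w om^-1.
have omI : lo < om^-1 < hi by rewrite hiA (lt_trans lo0).
have Jh y : k <= 1 + om^-1 * derive1 w (foot w om^-1 y).
  by apply: Hk; rewrite lexx ltW.
have cZ (t x : R) : 0 <= t -> {for (t, x), continuous (fun p : R * R => Z p.1 p.2)}.
  move=> t0.
  have c1 : {for (t, x), continuous (fun p : R * R => al p.1)}.
    apply: (@continuous_comp _ _ _ (fun p : R * R => p.1) al); first exact: cvg_fst.
    exact: (is_derive_continuous (Dal t)).
  have c2 : {for (t, x), continuous (fun p : R * R => p.2 - vs * p.1)}.
    apply: cvgB; first exact: cvg_snd.
    by apply: cvgM; [exact: cvg_cst|exact: cvg_fst].
  apply: (@continuous_comp _ _ _ (fun p : R * R => (al p.1, p.2 - vs * p.1))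
    (fun p => foot w p.1 p.2)); first exact: (cvg_pair c1 c2).
  exact: (continuous_foot c0 Cw1 Hc (alI t t0)).
have cont (t x : R) : 0 <= t ->
  [/\ {for (t, x), continuous (fun p : R * R => rho p.1 p.2)},
      {for (t, x), continuous (fun p : R * R => rt p.1 p.2)} &
      {for (t, x), continuous (fun p : R * R => rx p.1 p.2)}] /\
  [/\ {for (t, x), continuous (fun p : R * R => v p.1 p.2)},
      {for (t, x), continuous (fun p : R * R => vt p.1 p.2)} &
      {for (t, x), continuous (fun p : R * R => vx p.1 p.2)}].
  move=> t0; have {}cZ := cZ t x t0.
  have ce : {for (t, x), continuous (fun p : R * R => e p.1)}.
    apply: (@continuous_comp _ _ _ (fun p : R * R => p.1) e); first exact: cvg_fst.
    exact: (is_derive_continuous (De t)).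
  have cal : {for (t, x), continuous (fun p : R * R => al p.1)}.
    apply: (@continuous_comp _ _ _ (fun p : R * R => p.1) al); first exact: cvg_fst.
    exact: (is_derive_continuous (Dal t)).
  have comp (q : R -> R) : continuous q ->
      {for (t, x), continuous (fun p : R * R => q (Z p.1 p.2))}.
    move=> cq; apply: (@continuous_comp _ _ _ (fun p : R * R => Z p.1 p.2) q) => //.
    exact: cq.
  have crZ := comp r cr; have cr'Z := comp _ cr'; have cwZ := comp w cw.
  have cw'Z := comp _ cw'; have cw''Z := comp _ cw''.
  have cJ : {for (t, x), continuous (fun p : R * R => J p.1 p.2)}.
    by apply: cvgD; [exact: cvg_cst|exact: cvgM].
  have cJV : {for (t, x), continuous (fun p : R * R => (J p.1 p.2)^-1)}.
    by apply: cvgV => //; exact: Jgt0.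
  have cJV2 : {for (t, x), continuous (fun p : R * R => (J p.1 p.2 ^+ 2)^-1)}.
    apply: cvgV; first by rewrite expf_neq0//; exact: Jgt0.
    exact: (cvgM cJ cJ).
  have cZt : {for (t, x), continuous (fun p : R * R => Zt p.1 p.2)}.
    by apply: cvgM => //; apply: cvgB; [exact: cvg_cst|exact: cvgM].
  have cZx : {for (t, x), continuous (fun p : R * R => Zx p.1 p.2)}.
    apply: cvgM => //; apply: cvgB; first exact: cvg_cst.
    by apply: cvgM => //; exact: cvg_cst.
  split; split.
  - exact: cvgM.
  - apply: cvgB; first by apply: cvgM => //; exact: cvgM.
    by apply: cvgM => //; apply: cvgM => //; apply: cvgD; apply: cvgM => //; exact: cvgM.
  - apply: cvgB; first by apply: cvgM => //; exact: cvgM.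
    apply: cvgM => //; apply: cvgM => //; apply: cvgD; apply: cvgM => //.
      exact: cvg_cst.
    exact: cvgM.
  - by apply: cvgD; [exact: cvg_cst|exact: cvgM].
  - apply: cvgD; apply: cvgM => //; last exact: cvgM.
    by apply: cvgM => //; exact: cvg_cst.
  - by apply: cvgM => //; exact: cvgM.
have [C1r rtE rxE] := C1_half_planeP Drt Drx (fun t x t0 => let: And3 a _ _ := (cont t x t0).1 in a)
  (fun t x t0 => let: And3 _ a _ := (cont t x t0).1 in a)
  (fun t x t0 => let: And3 _ _ a := (cont t x t0).1 in a).
have [C1v vtE vxE] := C1_half_planeP Dvt Dvx (fun t x t0 => let: And3 a _ _ := (cont t x t0).2 in a)
  (fun t x t0 => let: And3 _ a _ := (cont t x t0).2 in a)
  (fun t x t0 => let: And3 _ _ a := (cont t x t0).2 in a).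
exists rho, v; split=> //.
(* With the explicit derivatives both equations are rational identities. Behind them is
   [Zt + v * Zx = 0]: the foot is constant along the flow of [v]. *)
- move=> t x t0; have Jn := Jgt0 t x t0.
  rewrite rtE// rxE// vxE// vtE//; split.
  + by apply: rb_bound; exact: Jk.
  + rewrite /rt /rx /vx /v /rho /density -/(Z t x) -/(J t x) /Zt /Zx.
    by field.
  + rewrite /vt /vx /v /Zt /Zx; by field.
- move=> x; have al0 : al 0 = 0 by rewrite /al /relaxation_time mulr0 oppr0 expR0 subrr mul0r.
  have Z0 : Z 0 x = x.
    have := footP x c0 Cw1 (fun z => Hc _ z (alI 0 (lexx 0))).
    by rewrite al0 mul0r addr0 /Z al0 mulr0 subr0.
  rewrite /rho /density -/(Z 0 x) /v Z0 al0 mul0r addr0 divr1.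
  by rewrite /e mulr0 oppr0 expR0 mul1r.
- by move=> t x; exists (Z t x); rewrite /v /e addrC addKr.
- exists h; split.
  + by move=> y; apply: rb_bound.
  (* Regularity of [h] comes from the same lemmas, with the parameter frozen at [om^-1] and the
     position as variable. *)
  + have DZ (y : R) := is_derive_foot (al := cst om^-1) (be := id) c0 Cw1 Hc omI
      (is_derive_cst _ y 1) (is_derive_id y 1).
    have Jn (y : R) : 1 + om^-1 * derive1 w (foot w om^-1 y) != 0.
      by rewrite gt_eqF// (lt_le_trans k0).
    have cF : continuous (foot w om^-1) by move=> y; exact: (is_derive_continuous (DZ y)).
    have Dh (y : R) := is_derive_jacobian_quotient Cr Cw (is_derive_cst om^-1 y 1)
      (DZ y) (Jn y).
    have comp (q : R -> R) (y : R) : continuous q ->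
        {for y, continuous (fun y => q (foot w om^-1 y))}.
      by move=> cq; apply: (@continuous_comp _ _ _ (foot w om^-1) q); [exact: cF|exact: cq].
    split; first by case=> // _ y _; case: (Dh y).
    move=> y _; rewrite derive1n1.
    pose F (y : R) : R := foot w om^-1 y.
    pose J1 (y : R) : R := 1 + om^-1 * derive1 w (F y).
    pose dF (y : R) : R := (1 - 0 * w (F y)) / J1 y.
    have -> : derive1 h = (fun y => derive1 r (F y) * dF y / J1 y - r (F y) *
        (0 * derive1 w (F y) + om^-1 * (derive1n 2 w (F y) * dF y)) / J1 y ^+ 2).
      by apply/funext => z; rewrite derive1E; exact: (@derive_val _ _ _ _ _ _ _ (Dh z)).
    have c1 := comp r y cr; have c2 := comp _ y cr'; have c3 := comp w y cw.
    have c4 := comp _ y cw'; have c5 := comp _ y cw''.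
    have cJ : {for y, continuous J1}.
      by apply: cvgD; [exact: cvg_cst|apply: cvgM => //; exact: cvg_cst].
    have cJV : {for y, continuous (fun y => (J1 y)^-1)} by apply: cvgV => //; exact: Jn.
    have cJV2 : {for y, continuous (fun y => (J1 y ^+ 2)^-1)}.
      by apply: cvgV; [rewrite expf_neq0//; exact: Jn|exact: (cvgM cJ cJ)].
    have cdF : {for y, continuous dF}.
      apply: cvgM => //; apply: cvgB; first exact: cvg_cst.
      by apply: cvgM => //; exact: cvg_cst.
    apply: cvgB; first by apply: cvgM => //; exact: cvgM.
    apply: cvgM => //; apply: cvgM => //; apply: cvgD; apply: cvgM => //.
    * exact: cvg_cst.
    * exact: cvg_cst.
    * exact: cvgM.
  + have Br : exists B : R, forall z : R, `|r z| <= B.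
      by exists (rb * k) => z; have /andP[r0 ?] := Hr z; rewrite ger0_norm// ltW.
    have [K HK] := density_lipschitz c0 Cr Cw Hc Br Br1 Bw Bw1 Bw2.
    (* The gap [om^-1 - al t] equals [e t / om], and the weight [expR (om * t)] cancels [e t]. *)
    exists (K / om) => t x t0; have [ala alb] := andP (alI t t0).
    have /andP[al0 alo] := relaxation_time_itv om0 t0.
    have := HK (al t) om^-1 (x - vs * t) ala alo hiA.
    have -> : om^-1 - al t = e t / om by rewrite /al /relaxation_time -/(e t); field.
    rewrite distrC => H.
    have -> : K / om = K * (e t / om) * expR (om * t).
      by rewrite /e expRN; field; rewrite omn0 gt_eqF// expR_gt0.
    by rewrite ler_wpM2r// expR_ge0.
Qed.

(** * Vanishing pressure, extended bounds and the theorem *)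

(** At [x = b] nothing is known to the right, but derivability lets the derivative be computed from
    left quotients, which are all 0. This covers densities equal to [rhobar]. *)
Lemma derive1_vanish_left (R : realType) (G : R -> R) (b x : R) :
  (forall y, 0 < y <= b -> G y = 0) -> 0 < x <= b -> derivable G x 1 ->
  derive1 G x = 0.
Proof.
move=> G0 xb; have /andP[x0 _] := xb; move=> /derivableP; rewrite derive1E.
move=> /is_derive1_caratheodory[q [qE cq <-]].
have : q y @[y --> x^'-] --> q x by exact: cvg_at_left_filter.
move=> /cvg_lim <- //; apply: cvg_lim => //.
apply: cvg_near_cst; near=> y.
have yx : y < x by near: y; exact: nbhs_left_lt.
have y0 : 0 < y by near: y; exact: nbhs_left_gt.
have := qE y; rewrite !G0 ?subrr//; last first.
  by rewrite y0 (le_trans (ltW yx))//; have /andP[] := xb.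
by move=> /esym/eqP; rewrite mulf_eq0 subr_eq0 (lt_eqF yx) orbF => /eqP.
Unshelve. all: by end_near. Qed.

(** The real lower bound [m] excludes -oo and the value [f 0] excludes +oo. *)
Lemma infR_fin (R : realType) (f : R -> R) (m : R) : (m%:E < infR f)%E ->
  exists i, [/\ infR f = i%:E, m < i & forall x, i <= f x].
Proof.
move=> mf; have fle x : (infR f <= (f x)%:E)%E by apply: ereal_inf_lbound; exists x.
have := fle 0; case: (infR f) mf fle => [i| |] // mi ile _.
by exists i; split=> // x; have := ile x; rewrite lee_fin.
Qed.

Lemma supR_leP (R : realType) (f : R -> R) (b : R) :
  (supR f <= b%:E)%E <-> forall x, f x <= b.
Proof.
split=> [fb x|fb]; last by apply: ge_ereal_sup => _ [x _ <-]; rewrite lee_fin.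
by rewrite -lee_fin (le_trans _ fb)//; apply: ereal_sup_ubound; exists x.
Qed.

Theorem mainTheorem6 (R : realType) (mu vmax vstar rhomax rhobar : R)
  (f Phi rho0 v0 : R -> R)
  (mu_gt0 : 0 < mu)
  (vstar_gt0 : 0 < vstar) (vstar_lt_vmax : vstar < vmax)
  (rhomax_gt0 : 0 < rhomax)
  (rhobar_gt0 : 0 < rhobar) (rhobar_lt_rhomax : rhobar < rhomax)
  (f_C1 : classC 1 setT f)
  (f_nondecreasing : {homo f : x y / x <= y})
  (f_ge : forall x : R, Num.max x 0 <= f x)
  (Phi_C3 : classC 3 `]0, rhomax[ Phi)
  (Phi_ge0 : forall r : R, 0 < r < rhomax -> 0 <= Phi r)
  (Phi_lim : Phi r @[r --> rhomax^'-] --> +oo)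
  (Phi_eq0 : forall r : R, 0 < r <= rhobar -> Phi r = 0)
  (Phi'_gt0 : forall r : R, rhobar < r < rhomax -> 0 < derive1 Phi r)
  (Phi''_ge0 : forall r : R, 0 < r < rhomax -> 0 <= derive1n 2 Phi r)
  (rho0_C1 : classC 1 setT rho0) (rho0_W : Wkinfty 1 rho0)
  (v0_C2 : classC 2 setT v0) (v0_W : Wkinfty 2 v0)
  (rho0_gt0 : forall x : R, 0 < rho0 x) :
  let g := relaxation_g vmax vstar f in
  let omega := mu + g 0 in
  ((- omega)%:E < infR (derive1 v0))%E ->
  (supR rho0 <= rhobar%:E * (1 + omega^-1%:E * mine 0 (infR (derive1 v0))))%E ->
  exists rho v : R -> R -> R,
    [/\ classical_solution mu vstar rhomax g Phi rho0 v0 rho v,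
        forall t : R, 0 <= t -> (supR (rho t) <= rhobar%:E)%E,
        forall t : R, 0 <= t ->
          (supR (fun x : R => `|v t x - vstar|%R) <=
           (expR (- (omega * t)))%:E * supR (fun x : R => `|v0 x - vstar|%R))%E,
        forall t x : R, 0 <= t -> 0 < rho t x &
        exists h : R -> R,
          [/\ forall y : R, 0 < h y <= rhobar,
              classC 1 setT h,
              Linfty h &
              (ereal_sup [set (`|rho t x - h (x - vstar * t)|
                               * expR (omega * t))%:E
                         | t in [set t : R | (0 <= t)%R] & x in [set: R]]
               < +oo)%E]].
Proof.
move=> g omega inf_v0' sup_rho0.
have f0_ge0 : 0 <= f 0 by apply: le_trans (f_ge 0); rewrite le_max lexx.
(* Nonnegativity of [f 0] makes [g 0] nonnegative, so [omega] is at least [mu]. *)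
have omega_gt0 : 0 < omega.
  rewrite /omega /g /relaxation_g mul0r subr0 ltr_pwDl//.
  have vmax_gt0 := lt_trans vstar_gt0 vstar_lt_vmax.
  by rewrite divr_ge0// mulr_ge0 ?subr_ge0// ltW.
have [i [infE om_i i_le]] := infR_fin inf_v0'.
(* As [m <= 0], the quantity [1 + a * m] is smallest on [[0, omega^-1]] at the right end, where it
   equals [k]. The bound on [v0'] makes [k] positive, and the bound on the initial density reads
   [rho0 x <= rhobar * k]. *)
pose m := Num.min 0 i; pose k := 1 + omega^-1 * m.
have m_le0 : m <= 0 by rewrite ge_min lexx.
have m_le x : m <= derive1 v0 x by rewrite ge_min i_le orbT.
have k_gt0 : 0 < k.
  suff : - 1 < omega^-1 * m by rewrite /k; lra.
  by rewrite mulrC ltr_pdivlMr// mulN1r lt_min oppr_lt0 omega_gt0.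
have rho0_le x : rho0 x <= rhobar * k.
  move: x; apply/supR_leP; move: sup_rho0.
  by rewrite infE -EFin_min.
pose w (x : R) : R := v0 x - vstar.
have wE : derive1 w = derive1 v0.
  apply/funext => x.
  have D := is_deriveB (classC_is_derive x v0_C2) (is_derive_cst vstar x 1).
  by rewrite [LHS]derive1E; apply: etrans (@derive_val _ _ _ _ _ _ _ D) _; rewrite subr0.
have w_C2 : classC 2 setT w.
  have [dv cv] := v0_C2; split=> [[_|j j2] x _|x _].
  - by apply: derivableB; [exact: (dv 0%N isT x I)|exact: derivable_cst].
  - by rewrite derive1Sn wE -derive1Sn; exact: (dv _ j2 x I).
  - by rewrite derive1Sn wE -derive1Sn; exact: (cv x I).
(* Order 0 turns the essential bound on [v0] into a pointwise one. *)
have [|B0 v0_bd] := @weak_derivative_bounded R 0 v0 _ (v0_W.2 0%N isT).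
  exact: classCW (classCW v0_C2).
have w_bd : exists B : R, forall z : R, `|w z| <= B.
  exists (B0 + `|vstar|) => z; apply: le_trans (ler_normB _ _) _.
  by rewrite lerD2r; exact: v0_bd.
have w'_bd : exists B : R, forall z : R, `|derive1 w z| <= B.
  by rewrite wE; exact: (weak_derivative_bounded (classCW v0_C2) (v0_W.2 1%N isT)).
have w''_bd : exists B : R, forall z : R, `|derive1n 2 w z| <= B.
  by rewrite derive1Sn wE; exact: (weak_derivative_bounded v0_C2 (v0_W.2 2%N isT)).
have rho0'_bd := weak_derivative_bounded rho0_C1 (rho0_W.2 1%N isT).
have Hk (a z : R) : 0 <= a <= omega^-1 -> k <= 1 + a * derive1 w z.
  move=> /andP[a0 a_om]; rewrite wE lerD2l (@le_trans _ _ (a * m))//.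
    by rewrite ler_wnM2r.
  by rewrite ler_wpM2l.
have Hr (z : R) : 0 < rho0 z <= rhobar * k by rewrite rho0_gt0 rho0_le.
have [rho [v [[C1rho C1v] sol init vE [h [h_rng h_C1 [K hK]]]]]] :=
  relaxed_transport vstar omega_gt0 k_gt0 rho0_C1 w_C2 rho0'_bd w_bd w'_bd w''_bd Hk Hr.
have [dPhi _] := Phi_C3.
have rho_in (t x : R) : 0 <= t -> `]0, rhomax[%classic (rho t x).
  move=> t0; have [/andP[r0 rb] _ _] := sol t x t0.
  by rewrite /= in_itv/= r0 (le_lt_trans rb).
have in_dom (r : R) : 0 < r <= rhobar -> `]0, rhomax[%classic r.
  by move=> /andP[r0 rb]; rewrite /= in_itv/= r0 (le_lt_trans rb).
have Phi'_eq0 (r : R) : 0 < r <= rhobar -> derive1 Phi r = 0.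
  by move=> rb; apply: (derive1_vanish_left Phi_eq0 rb); exact: (dPhi 0%N isT r (in_dom r rb)).
have Phi''_eq0 (r : R) : 0 < r <= rhobar -> derive1n 2 Phi r = 0.
  by move=> rb; apply: (derive1_vanish_left Phi'_eq0 rb); exact: (dPhi 1%N isT r (in_dom r rb)).
(* The density never leaves the region where [Phi] and its first two derivatives vanish, so the
   relaxation rate [mu + g (Xi Phi rho t x)] is the constant [omega]. *)
have Xi_eq0 (t x : R) : 0 <= t -> Xi Phi rho t x = 0.
  move=> t0; have [rb _ _] := sol t x t0.
  by rewrite /Xi Phi'_eq0// Phi''_eq0// !mulr0 addr0 mulr0.
exists rho, v; split.
- split=> //.
  + by move=> t x t0; have [] := sol t x t0.
  + move=> t x t0; have [_ _ ->] := sol t x t0.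
    by rewrite Xi_eq0// subr0 mulNr.
  + by move=> x; have [] := init x.
  + by move=> x; have [_ ->] := init x; rewrite /w addrC subrK.
- by move=> t t0; apply/supR_leP => x; have [/andP[]] := sol t x t0.
(* Each deviation at time [t] is a damped value of the initial deviation at some point [z]. *)
- move=> t t0; apply: ge_ereal_sup => _ [x _ <-]; have [z ->] := vE t x.
  rewrite normrM (gtr0_norm (expR_gt0 _)) EFinM lee_wpmul2l ?lee_fin ?expR_ge0//.
  by apply: ereal_sup_ubound; exists z.
- by move=> t x t0; have [/andP[]] := sol t x t0.
- exists h; split=> //.
    apply: (@bounded_continuous_Linfty _ _ rhobar).
      exact: classC_continuous h_C1.
    by move=> y; have /andP[h0 hb] := h_rng y; rewrite ger0_norm// ltW.
  apply: (@le_lt_trans _ _ K%:E); last exact: ltry.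
  by apply: ge_ereal_sup => _ [t /= t0 [x _ <-]]; rewrite lee_fin; exact: hK.
Qed.
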